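(* Let $n\ge1$, let $\rho$ be a representation of $\mathrm{Pol}(S_n^+)$ on a Hilbert space $\mathsf{h}$, and let $\xi_1,\ldots,\xi_n\in\mathsf{h}$ satisfy $$\rho(p_{ii})\xi_i=0\quad\text{and}\quad \rho(p_{ij})\xi_i=\rho(p_{ij})\xi_j\quad\text{for all } i,j=1,\ldots,n.$$ Then: (1) There exists a unique $\rho$-$\varepsilon$-cocycle $\eta:\mathrm{Pol}(S_n^+)\to\mathsf{h}$ such that $\eta(p_{ii})=\xi_i$ for $i=1,\ldots,n$ and $\eta(1)=0$. (2) There exists a unique functional $L:\mathrm{Pol}(S_n^+)\to\mathbb{C}$ such that $(\rho,\eta,L)$ is a Schürmann triple. (3) If $\xi_1=\cdots=\xi_n$, then the unique cocycle $\eta$ with $\eta(p_{ii})=\xi_i$, $i=1,\ldots,n$, is a 1-coboundary.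
   Context: $\mathrm{Pol}(S_n^+)$ is the universal unital $*$-algebra generated by elements $p_{ij}$ ($1\le i,j\le n$) subject to $p_{ij}=p_{ij}^*=p_{ij}^2$, $p_{ij}p_{ik}=0=p_{ji}p_{ki}$ for $j\ne k$, and $\sum_{j=1}^n p_{ij}=\sum_{j=1}^n p_{ji}=1$ for all $i$. Its counit is the character $\varepsilon$ with $\varepsilon(p_{ij})=\delta_{ij}$. A representation on a Hilbert space $\mathsf{h}$ is a unital $*$-homomorphism $\rho:\mathrm{Pol}(S_n^+)\to B(\mathsf{h})$. A $\rho$-$\varepsilon$-cocycle is a linear map $\eta:\mathrm{Pol}(S_n^+)\to\mathsf{h}$ with $\eta(ab)=\rho(a)\eta(b)+\eta(a)\varepsilon(b)$ for all $a,b$. It is a 1-coboundary if there is a vector $v\in\mathsf{h}$ with $\eta(a)=(\rho(a)-\varepsilon(a)\mathrm{id}_{\mathsf{h}})v$ for all $a$. Inner products are linear in the second argument. $(\rho,\eta,L)$ is a Schürmann triple if $\rho$ is a representation, $\eta$ is a $\rho$-$\varepsilon$-cocycle, and $L$ is a hermitian linear functional ($L(a^* )=\overline{L(a)}$) with $L(a^*b)=\langle\eta(a),\eta(b)\rangle+\varepsilon(a^* )L(b)+L(a^* )\varepsilon(b)$ for all $a,b$. *)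

(* Defs.v *)
From HB Require Import structures.
From mathcomp Require Import all_boot all_order all_algebra generic_quotient.
From mathcomp Require Import complex.
From mathcomp Require Import boolp classical_sets reals topology normedtype.

Set Implicit Arguments.
Unset Strict Implicit.
Unset Printing Implicit Defensive.

Import Order.TTheory GRing.Theory Num.Theory.
Import numFieldNormedType.Exports.

Local Open Scope ring_scope.
Local Open Scope quotient_scope.
Local Open Scope complex_scope.

(* [C] plays the role of the complex numbers; [Num.conj] is its conjugation. *)
HB.mixin Record Algebra_isStarAlgebra (C : numClosedFieldType) A
    of GRing.Algebra C A := {
  star : A -> A;
  starK : involutive star;
  starD : {morph star : a b / a + b};
  starZ : forall (c : C) (a : A), star (c *: a) = Num.conj c *: star a;
  starM : forall a b, star (a * b) = star b * star a
}.

#[short(type="starAlgType")]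
HB.structure Definition StarAlgebra (C : numClosedFieldType) :=
  {A of Algebra_isStarAlgebra C A & GRing.Algebra C A}.

Section RegularStar.
Variable C : numClosedFieldType.

Lemma regular_starK : involutive (Num.conj : C^o -> C^o).
Proof. exact: conjCK. Qed.

Lemma regular_starD : {morph (Num.conj : C^o -> C^o) : a b / a + b}.
Proof. exact: rmorphD. Qed.

Lemma regular_starZ (c : C) (a : C^o) :
  (Num.conj (c *: a : C) : C^o) = Num.conj c *: (Num.conj (a : C) : C^o).
Proof. exact: rmorphM. Qed.

Lemma regular_starM (a b : C^o) :
  (Num.conj (a * b : C) : C^o)
  = (Num.conj (b : C) : C^o) * (Num.conj (a : C) : C^o).
Proof. by rewrite mulrC; exact: rmorphM. Qed.

HB.instance Definition _ := Algebra_isStarAlgebra.Build C C^o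
  regular_starK regular_starD regular_starZ regular_starM.

End RegularStar.

Record star_hom (C : numClosedFieldType) (A B : starAlgType C) (f : A -> B)
    : Prop := StarHom {
  star_hom_linear : linear f;
  star_hom1 : f 1 = 1;
  star_homM : {morph f : a b / a * b};
  star_homS : {morph f : a / star a}
}.

Record magic_unitary (C : numClosedFieldType) (B : starAlgType C) (n : nat)
    (q : 'I_n -> 'I_n -> B) : Prop := MagicUnitary {
  magic_selfadj : forall i j, q i j = star (q i j);
  magic_idem : forall i j, q i j = q i j ^+ 2;
  magic_row_orth : forall i j k, j != k -> q i j * q i k = 0;
  magic_col_orth : forall i j k, j != k -> q j i * q k i = 0;
  magic_row_sum : forall i, \sum_(j < n) q i j = 1;
  magic_col_sum : forall i, \sum_(j < n) q j i = 1
}.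

(* [Pol] is Pol(S_n^+): the algebra of *-polynomial expressions in the symbols p_ij, modulo
   the smallest congruence [expr_eq] containing the axioms of unital
   *-algebras over [C] and the defining relations. *)
Section Pol.
Variables (C : numClosedFieldType) (n : nat).

Inductive expr : Type :=
  | Gen of 'I_n & 'I_n
  | Cst of C
  | Add of expr & expr
  | Mul of expr & expr
  | Star of expr.

HB.instance Definition _ := gen_eqMixin expr.
HB.instance Definition _ := gen_choiceMixin expr.

Inductive expr_eq : expr -> expr -> Prop :=
  | ee_refl x : expr_eq x x
  | ee_sym x y : expr_eq x y -> expr_eq y x
  | ee_trans x y z : expr_eq x y -> expr_eq y z -> expr_eq x z
  | ee_Add x x' y y' :
      expr_eq x x' -> expr_eq y y' -> expr_eq (Add x y) (Add x' y')
  | ee_Mul x x' y y' :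
      expr_eq x x' -> expr_eq y y' -> expr_eq (Mul x y) (Mul x' y')
  | ee_Star x x' : expr_eq x x' -> expr_eq (Star x) (Star x')
  | ee_addA x y z : expr_eq (Add x (Add y z)) (Add (Add x y) z)
  | ee_addC x y : expr_eq (Add x y) (Add y x)
  | ee_add0 x : expr_eq (Add (Cst 0) x) x
  | ee_addN x : expr_eq (Add (Mul (Cst (-1)) x) x) (Cst 0)
  | ee_mulA x y z : expr_eq (Mul x (Mul y z)) (Mul (Mul x y) z)
  | ee_mul1 x : expr_eq (Mul (Cst 1) x) x
  | ee_mulDl x y z : expr_eq (Mul (Add x y) z) (Add (Mul x z) (Mul y z))
  | ee_mulDr x y z : expr_eq (Mul x (Add y z)) (Add (Mul x y) (Mul x z))
  | ee_CstD a b : expr_eq (Cst (a + b)) (Add (Cst a) (Cst b))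
  | ee_CstM a b : expr_eq (Cst (a * b)) (Mul (Cst a) (Cst b))
  | ee_CstC a x : expr_eq (Mul (Cst a) x) (Mul x (Cst a))
  | ee_starK x : expr_eq (Star (Star x)) x
  | ee_starD x y : expr_eq (Star (Add x y)) (Add (Star x) (Star y))
  | ee_starM x y : expr_eq (Star (Mul x y)) (Mul (Star y) (Star x))
  | ee_starC a : expr_eq (Star (Cst a)) (Cst (Num.conj a))
  | ee_selfadj i j : expr_eq (Gen i j) (Star (Gen i j))
  | ee_idem i j : expr_eq (Gen i j) (Mul (Gen i j) (Gen i j))
  | ee_row_orth i j k : j != k -> expr_eq (Mul (Gen i j) (Gen i k)) (Cst 0)
  | ee_col_orth i j k : j != k -> expr_eq (Mul (Gen j i) (Gen k i)) (Cst 0)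
  | ee_row_sum i : expr_eq (\big[Add/Cst 0]_(j < n) Gen i j) (Cst 1)
  | ee_col_sum i : expr_eq (\big[Add/Cst 0]_(j < n) Gen j i) (Cst 1).

Definition expr_eqb (x y : expr) : bool := `[< expr_eq x y >].

Lemma expr_eqb_refl : reflexive expr_eqb.
Proof. by move=> x; apply/asboolP; exact: ee_refl. Qed.

Lemma expr_eqb_sym : symmetric expr_eqb.
Proof. by move=> x y; apply/asboolP/asboolP; exact: ee_sym. Qed.

Lemma expr_eqb_trans : transitive expr_eqb.
Proof.
by move=> y x z /asboolP xy /asboolP yz; apply/asboolP; exact: ee_trans yz.
Qed.

Canonical expr_equiv :=
  EquivRel expr_eqb expr_eqb_refl expr_eqb_sym expr_eqb_trans.

Definition Pol : Type := {eq_quot expr_equiv}.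
HB.instance Definition _ : EqQuotient expr expr_equiv Pol :=
  EqQuotient.on Pol.
HB.instance Definition _ := Choice.on Pol.

Lemma pi_eqP (x y : expr) : reflect (\pi_Pol x = \pi_Pol y) (expr_eqb x y).
Proof. exact: (eqmodP expr_equiv). Qed.

Lemma pi_eq (x y : expr) : \pi_Pol x = \pi_Pol y <-> expr_eq x y.
Proof. by split=> [/pi_eqP/asboolP|/asboolP/pi_eqP]. Qed.

Lemma repr_eq (x : expr) : expr_eq (repr (\pi_Pol x)) x.
Proof. by apply/pi_eq; rewrite reprK. Qed.

Definition pol_add (a b : Pol) : Pol := \pi_Pol (Add (repr a) (repr b)).
Definition pol_mul (a b : Pol) : Pol := \pi_Pol (Mul (repr a) (repr b)).
Definition pol_star (a : Pol) : Pol := \pi_Pol (Star (repr a)).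
Definition pol_cst (c : C) : Pol := \pi_Pol (Cst c).
Definition pol_opp (a : Pol) : Pol := pol_mul (pol_cst (-1)) a.

Lemma pi_Add x y : \pi_Pol (Add x y) = pol_add (\pi_Pol x) (\pi_Pol y).
Proof. by apply/pi_eq/ee_Add; exact/ee_sym/repr_eq. Qed.

Lemma pi_Mul x y : \pi_Pol (Mul x y) = pol_mul (\pi_Pol x) (\pi_Pol y).
Proof. by apply/pi_eq/ee_Mul; exact/ee_sym/repr_eq. Qed.

Lemma pi_Star x : \pi_Pol (Star x) = pol_star (\pi_Pol x).
Proof. by apply/pi_eq/ee_Star; exact/ee_sym/repr_eq. Qed.

Lemma pol_ind (P : Pol -> Prop) :
  (forall x, P (\pi_Pol x)) -> forall a, P a.
Proof. by move=> Px a; rewrite -[a]reprK. Qed.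

Lemma pol_addA : associative pol_add.
Proof.
elim/pol_ind=> x; elim/pol_ind=> y; elim/pol_ind=> z.
by rewrite -!pi_Add; exact/pi_eq/ee_addA.
Qed.

Lemma pol_addC : commutative pol_add.
Proof.
elim/pol_ind=> x; elim/pol_ind=> y.
by rewrite -!pi_Add; exact/pi_eq/ee_addC.
Qed.

Lemma pol_add0 : left_id (pol_cst 0) pol_add.
Proof. by elim/pol_ind=> x; rewrite -!pi_Add; exact/pi_eq/ee_add0. Qed.

Lemma pol_addN : left_inverse (pol_cst 0) pol_opp pol_add.
Proof.
by elim/pol_ind=> x; rewrite /pol_opp -pi_Mul -pi_Add; exact/pi_eq/ee_addN.
Qed.

HB.instance Definition _ :=
  GRing.isZmodule.Build Pol pol_addA pol_addC pol_add0 pol_addN.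

Lemma piD x y : \pi_Pol (Add x y) = \pi_Pol x + \pi_Pol y.
Proof. exact: pi_Add. Qed.

Lemma pol_mulA : associative pol_mul.
Proof.
elim/pol_ind=> x; elim/pol_ind=> y; elim/pol_ind=> z.
by rewrite -!pi_Mul; exact/pi_eq/ee_mulA.
Qed.

Lemma pol_mul1 : left_id (pol_cst 1) pol_mul.
Proof. by elim/pol_ind=> x; rewrite -pi_Mul; exact/pi_eq/ee_mul1. Qed.

Lemma pol_cstC c a : pol_mul (pol_cst c) a = pol_mul a (pol_cst c).
Proof. by elim/pol_ind: a => x; rewrite -!pi_Mul; exact/pi_eq/ee_CstC. Qed.

Lemma pol_1mul : right_id (pol_cst 1) pol_mul.
Proof. by move=> a; rewrite -pol_cstC pol_mul1. Qed.

Lemma pol_mulDl : left_distributive pol_mul +%R.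
Proof.
elim/pol_ind=> x; elim/pol_ind=> y; elim/pol_ind=> z.
by rewrite -piD -!pi_Mul -piD; exact/pi_eq/ee_mulDl.
Qed.

Lemma pol_mulDr : right_distributive pol_mul +%R.
Proof.
elim/pol_ind=> x; elim/pol_ind=> y; elim/pol_ind=> z.
by rewrite -piD -!pi_Mul -piD; exact/pi_eq/ee_mulDr.
Qed.

Fixpoint eval (B : starAlgType C) (q : 'I_n -> 'I_n -> B) (x : expr) : B :=
  match x with
  | Gen i j => q i j
  | Cst c => c%:A
  | Add x y => eval q x + eval q y
  | Mul x y => eval q x * eval q y
  | Star x => star (eval q x)
  end.

Lemma star1 (B : starAlgType C) : star (1 : B) = 1.
Proof. by rewrite -[LHS]mul1r -{1}[1]starK -starM mul1r starK. Qed.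

Lemma eval_sum (B : starAlgType C) (q : 'I_n -> 'I_n -> B)
    (x : 'I_n -> expr) :
  eval q (\big[Add/Cst 0]_(j < n) x j) = \sum_(j < n) eval q (x j).
Proof.
elim/big_rec2: _ => [|j u v _ <- //]; exact: scale0r.
Qed.

Lemma eval_eq (B : starAlgType C) (q : 'I_n -> 'I_n -> B) x y :
  magic_unitary q -> expr_eq x y -> eval q x = eval q y.
Proof.
move=> [qS qI qr qc qrs qcs]; elim=> {x y} /=.
- by [].
- by move=> x y _ ->.
- by move=> x y z _ -> _ ->.
- by move=> x x' y y' _ -> _ ->.
- by move=> x x' y y' _ -> _ ->.
- by move=> x x' _ ->.
- by move=> *; rewrite addrA.
- by move=> *; rewrite addrC.
- by move=> *; rewrite scale0r add0r.
- by move=> x; rewrite scaleN1r mulN1r addNr scale0r.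
- by move=> *; rewrite mulrA.
- by move=> *; rewrite scale1r mul1r.
- by move=> *; rewrite mulrDl.
- by move=> *; rewrite mulrDr.
- by move=> *; rewrite scalerDl.
- by move=> *; rewrite -scalerAl mul1r scalerA.
- by move=> *; rewrite -scalerAl -scalerAr mul1r mulr1.
- by move=> *; rewrite starK.
- by move=> *; rewrite starD.
- by move=> *; rewrite starM.
- by move=> *; rewrite starZ star1.
- by move=> *; exact: qS.
- by move=> i j; rewrite -expr2; exact: qI.
- by move=> *; rewrite qr // scale0r.
- by move=> *; rewrite qc // scale0r.
- by move=> *; rewrite eval_sum qrs scale1r.
- by move=> *; rewrite eval_sum qcs scale1r.
Qed.

Definition delta_gen (i j : 'I_n) : C^o := (i == j)%:R.

Lemma delta_magic : magic_unitary delta_gen.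
Proof.
rewrite /delta_gen; split.
- by move=> i j; rewrite /star /= rmorph_nat.
- by move=> i j; case: (i == j); rewrite ?expr1n ?expr0n.
- move=> i j k jk; case: (eqVneq i j) => [->|_]; last by rewrite mul0r.
  by rewrite (negPf jk) mulr0.
- move=> i j k jk; case: (eqVneq j i) => [<-|_]; last by rewrite mul0r.
  by rewrite eq_sym (negPf jk) mulr0.
- move=> i; rewrite (bigD1 i) //= eqxx big1 ?addr0 // => j.
  by rewrite eq_sym => /negPf ->.
- move=> i; rewrite (bigD1 i) //= eqxx big1 ?addr0 // => j.
  by move=> /negPf ->.
Qed.

Lemma pol_1neq0 : pol_cst 1 != 0.
Proof.
apply/eqP => /pi_eq /(eval_eq delta_magic) /=.
by rewrite scale0r scale1r => /eqP; rewrite oner_eq0.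
Qed.

HB.instance Definition _ := GRing.Zmodule_isNzRing.Build Pol
  pol_mulA pol_mul1 pol_1mul pol_mulDl pol_mulDr pol_1neq0.

Lemma piM x y : \pi_Pol (Mul x y) = \pi_Pol x * \pi_Pol y.
Proof. exact: pi_Mul. Qed.

Definition pol_scale (c : C) (a : Pol) : Pol := pol_cst c * a.

Lemma pol_cstM c d : pol_cst (c * d) = pol_cst c * pol_cst d.
Proof. by rewrite -piM; exact/pi_eq/ee_CstM. Qed.

Lemma pol_cstD c d : pol_cst (c + d) = pol_cst c + pol_cst d.
Proof. by rewrite -piD; exact/pi_eq/ee_CstD. Qed.

Lemma pol_scalerA c d a : pol_scale c (pol_scale d a) = pol_scale (c * d) a.
Proof. by rewrite /pol_scale mulrA pol_cstM. Qed.

Lemma pol_scale1r : left_id 1 pol_scale.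
Proof. by move=> a; rewrite /pol_scale mul1r. Qed.

Lemma pol_scalerDr : right_distributive pol_scale +%R.
Proof. by move=> c a b; rewrite /pol_scale mulrDr. Qed.

Lemma pol_scalerDl a : {morph pol_scale^~ a : c d / c + d}.
Proof. by move=> c d; rewrite /pol_scale pol_cstD mulrDl. Qed.

HB.instance Definition _ := GRing.Zmodule_isLmodule.Build C Pol
  pol_scalerA pol_scale1r pol_scalerDr pol_scalerDl.

Lemma pol_scalerAl (c : C) (a b : Pol) : c *: (a * b) = (c *: a) * b.
Proof. by rewrite /GRing.scale /= /pol_scale mulrA. Qed.

HB.instance Definition _ := GRing.Lmodule_isLalgebra.Build C Pol pol_scalerAl.

Lemma pol_scalerAr (c : C) (a b : Pol) : c *: (a * b) = a * (c *: b).
Proof.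
rewrite /GRing.scale /= /pol_scale !mulrA; congr (_ * _); exact: pol_cstC.
Qed.

HB.instance Definition _ := GRing.Lalgebra_isAlgebra.Build C Pol pol_scalerAr.

Lemma pol_starK : involutive pol_star.
Proof. by elim/pol_ind=> x; rewrite -!pi_Star; exact/pi_eq/ee_starK. Qed.

Lemma pol_starD : {morph pol_star : a b / a + b}.
Proof.
elim/pol_ind=> x; elim/pol_ind=> y.
by rewrite -piD -!pi_Star -piD; exact/pi_eq/ee_starD.
Qed.

Lemma pol_starM a b : pol_star (a * b) = pol_star b * pol_star a.
Proof.
elim/pol_ind: a => x; elim/pol_ind: b => y.
by rewrite -piM -!pi_Star -piM; exact/pi_eq/ee_starM.
Qed.

Lemma pol_starZ (c : C) (a : Pol) :
  pol_star (c *: a) = Num.conj c *: pol_star a.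
Proof.
rewrite [LHS]pol_starM -pi_Star (_ : \pi_Pol _ = pol_cst (Num.conj c)).
  by symmetry; exact: pol_cstC.
exact/pi_eq/ee_starC.
Qed.

HB.instance Definition _ := Algebra_isStarAlgebra.Build C Pol
  pol_starK pol_starD pol_starZ pol_starM.

Lemma piS x : \pi_Pol (Star x) = star (\pi_Pol x).
Proof. exact: pi_Star. Qed.

Lemma piZ c x : \pi_Pol (Mul (Cst c) x) = c *: \pi_Pol x.
Proof. exact: pi_Mul. Qed.

Definition pgen (i j : 'I_n) : Pol := \pi_Pol (Gen i j).

Lemma pi_sum (x : 'I_n -> expr) :
  \pi_Pol (\big[Add/Cst 0]_(j < n) x j) = \sum_(j < n) \pi_Pol (x j).
Proof.
by elim/big_rec2: _ => [//|j u v _ <-]; rewrite piD.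
Qed.

Lemma pgen_magic : magic_unitary pgen.
Proof.
split.
- move=> i j; rewrite -piS; exact/pi_eq/ee_selfadj.
- move=> i j; rewrite expr2 -piM; exact/pi_eq/ee_idem.
- move=> i j k jk; rewrite -piM; exact/pi_eq/ee_row_orth.
- move=> i j k jk; rewrite -piM; exact/pi_eq/ee_col_orth.
- move=> i; rewrite -pi_sum; exact/pi_eq/ee_row_sum.
- move=> i; rewrite -pi_sum; exact/pi_eq/ee_col_sum.
Qed.

(* A *-homomorphism only if [q] is a magic unitary. *)
Definition pol_lift (B : starAlgType C) (q : 'I_n -> 'I_n -> B) (a : Pol) : B :=
  eval q (repr a).

Section UniversalProperty.
Variables (B : starAlgType C) (q : 'I_n -> 'I_n -> B).
Hypothesis qM : magic_unitary q.

Lemma pol_lift_pi x : pol_lift q (\pi_Pol x) = eval q x.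
Proof. exact/(eval_eq qM)/repr_eq. Qed.

Lemma pol_lift_pgen i j : pol_lift q (pgen i j) = q i j.
Proof. by rewrite pol_lift_pi. Qed.

Lemma pol_lift_hom : star_hom (pol_lift q).
Proof.
split.
- move=> c; elim/pol_ind=> x; elim/pol_ind=> y.
  rewrite -piZ -piD !pol_lift_pi /=.
  by rewrite -scalerAl mul1r.
- by rewrite [1]/(pol_cst 1) pol_lift_pi /= scale1r.
- elim/pol_ind=> x; elim/pol_ind=> y.
  by rewrite -piM !pol_lift_pi.
- by elim/pol_ind=> x; rewrite {1}/star /= -pi_Star !pol_lift_pi.
Qed.

Lemma pol_lift_unique (f : Pol -> B) :
  star_hom f -> (forall i j, f (pgen i j) = q i j) -> f =1 pol_lift q.
Proof.
move=> [fL f1 fM fS] fp; elim/pol_ind=> x; rewrite pol_lift_pi.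
have fD a b : f (a + b) = f a + f b by have := fL 1 a b; rewrite !scale1r.
elim: x => [i j|c|x IHx y IHy|x IHx y IHy|x IHx] /=.
- exact: fp.
- have f0 : f 0 = 0 by apply: (addIr (f 0)); rewrite -fD !add0r.
  have -> : \pi_Pol (Cst c) = c *: (1 : Pol) + 0.
    by rewrite addr0 /GRing.scale /= /pol_scale mulr1.
  by rewrite fL f1 f0 addr0.
- by rewrite piD fD IHx IHy.
- by rewrite piM fM IHx IHy.
- by rewrite piS fS IHx.
Qed.

End UniversalProperty.

Definition counit : Pol -> C := pol_lift delta_gen.

Lemma counit_pgen i j : counit (pgen i j) = (i == j)%:R.
Proof. exact: (pol_lift_pgen delta_magic). Qed.

Lemma counit_hom : star_hom (counit : Pol -> C^o).
Proof. exact: (pol_lift_hom delta_magic). Qed.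

End Pol.

Arguments pgen {C n} i j.
Arguments counit {C n} a.

(* Linear in the second argument; the last axiom says that the complete norm
   is the one induced by the inner product, which is thus positive definite. *)
HB.mixin Record CompleteNormedModule_isHilbert (R : realType) H
    of CompleteNormedModule R[i] H := {
  inner : H -> H -> R[i];
  inner_linear : forall u : H, scalar (inner u);
  inner_conj : forall u v : H, inner v u = Num.conj (inner u v);
  inner_norm : forall u : H, inner u u = `|u| ^+ 2
}.

#[short(type="hilbertType")]
HB.structure Definition Hilbert (R : realType) :=
  {H of CompleteNormedModule_isHilbert R H & CompleteNormedModule R[i] H}.

Section Cocycles.
Variables (R : realType) (A : starAlgType R[i]) (h : hilbertType R).

(* Unital *-homomorphisms from A to B(h). *)
Record representation (rho : A -> h -> h) : Prop := Representation {
  rep_op_linear : forall a, linear (rho a);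
  rep_op_bounded : forall a,
    exists M : R[i], forall v, `|rho a v| <= M * `|v|;
  rep_linear : forall (c : R[i]) a b v,
    rho (c *: a + b) v = c *: rho a v + rho b v;
  rep1 : forall v, rho 1 v = v;
  repM : forall a b v, rho (a * b) v = rho a (rho b v);
  repS : forall a u v, inner (rho (star a) u) v = inner u (rho a v)
}.

Variables (eps : A -> R[i]) (rho : A -> h -> h).

Definition cocycle (eta : A -> h) : Prop :=
  linear eta /\
  forall a b, eta (a * b) = rho a (eta b) + eps b *: eta a.

Definition coboundary (eta : A -> h) : Prop :=
  exists v : h, forall a, eta a = rho a v - eps a *: v.

Record schurmann_triple (eta : A -> h) (L : A -> R[i]) : Prop :=
  SchurmannTriple {
  schurmann_rep : representation rho;
  schurmann_cocycle : cocycle eta;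
  schurmann_linear : scalar L;
  schurmann_hermitian : forall a, L (star a) = Num.conj (L a);
  schurmann_product : forall a b,
    L (star a * b)
    = inner (eta a) (eta b) + eps (star a) * L b + L (star a) * eps b
}.

End Cocycles.

(* Main.v *)
From HB Require Import structures.
Require Import Defs.
From mathcomp Require Import all_boot all_order all_algebra generic_quotient complex.
From mathcomp Require Import boolp reals topology normedtype ring.

(** The data of a Schürmann triple (rho, eta, L) on a *-algebra A with character
    eps can be packed into one unital *-homomorphism: on C + h + C, the operator
    with upper triangular block matrix

      [ eps a   <eta (a^* )|   L a      ]
      [ 0       rho a         |eta a>  ]
      [ 0       0             eps a    ]

    is multiplicative in a exactly because eta is a cocycle and L satisfies
    the product formula. The *-operation on these matrices is the adjoint
    followed by the exchange of the two copies of C. The algebra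
    [schurmann_alg] consists of the tuples (a, v, w, l) that describe matrices
    of this shape with arbitrary last column v, vector w in the first row and
    corner l. Consequently *-homomorphisms from A into it that are sections of
    the projection (a, v, w, l) |-> a are Schürmann triples
    ([salg_section_schurmann]), and for A = Pol(S_n^+) they are produced by the
    universal property from a magic unitary in [schurmann_alg].

    To find this magic unitary, note that every vector xi yields an inner
    *-homomorphism [salg_inner] xi on A, whose cocycle is the coboundary
    [cobord], a |-> eps a xi - rho a xi, and whose functional is
    a |-> <xi, rho a xi> - eps a <xi, xi>. Put
    q_ij = salg_inner (xi_i) p_ij. All relations within row i hold because they
    are images of relations under the single homomorphism salg_inner (xi_i).
    The hypothesis rho p_ij xi_i = rho p_ij xi_j says that also
    q_ij = salg_inner (xi_j) p_ij, so the relations within column j hold for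
    the same reason. Existence of eta and L follows at once.

    Uniqueness: as the generators are selfadjoint, they generate Pol(S_n^+)
    as an algebra ([pol_alg_ind]), so eta and L are determined by their
    values at the p_ij. A cocycle maps p_ij = p_ij (1 - p_ii), i <> j, to
    -rho p_ij eta p_ii, and L p_ij is determined by eta p_ij because p_ij is a
    projection. If all xi_i equal xi, the coboundary a |-> eps a xi - rho a xi
    takes the prescribed values at the p_ii, hence is eta. *)

Set Implicit Arguments.
Unset Strict Implicit.

Import Order.TTheory GRing.Theory Num.Theory.
Local Open Scope ring_scope.
Local Open Scope complex_scope.
Local Open Scope quotient_scope.

(** * Hilbert spaces, *-homomorphisms and representations *)

Section Inner.
Variables (R : realType) (h : hilbertType R).
Implicit Types u v w : h.

Lemma innerDr u v w : inner u (v + w) = inner u v + inner u w.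
Proof. by have := inner_linear u 1 v w; rewrite scale1r mul1r. Qed.

Lemma inner0r u : inner u 0 = 0.
Proof. by apply: (addIr (inner u 0)); rewrite -innerDr !add0r. Qed.

Lemma innerZr c u v : inner u (c *: v) = c * inner u v.
Proof. by have := inner_linear u c v 0; rewrite inner0r !addr0. Qed.

Lemma innerDl u v w : inner (u + v) w = inner u w + inner v w.
Proof. by rewrite !(inner_conj w) innerDr rmorphD. Qed.

Lemma inner0l u : inner 0 u = 0.
Proof. by rewrite inner_conj inner0r rmorph0. Qed.

Lemma innerZl c u v : inner (c *: u) v = Num.conj c * inner u v.
Proof. by rewrite !(inner_conj v) innerZr rmorphM. Qed.

Lemma innerBr u v w : inner u (v - w) = inner u v - inner u w.
Proof. by rewrite innerDr -scaleN1r innerZr mulN1r. Qed.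

Lemma innerBl u v w : inner (u - v) w = inner u w - inner v w.
Proof. by rewrite !(inner_conj w) innerBr rmorphB. Qed.

End Inner.

Section StarHom.
Variables (C : numClosedFieldType) (A B : starAlgType C) (f : A -> B).
Hypothesis hf : star_hom f.

Lemma star_homD a b : f (a + b) = f a + f b.
Proof. by have := star_hom_linear hf 1 a b; rewrite !scale1r. Qed.

Lemma star_hom0 : f 0 = 0.
Proof. by apply: (addIr (f 0)); rewrite -star_homD !add0r. Qed.

Lemma star_homZ c a : f (c *: a) = c *: f a.
Proof. by have := star_hom_linear hf c a 0; rewrite star_hom0 !addr0. Qed.

Lemma star_hom_sum n (x : 'I_n -> A) :
  f (\sum_(j < n) x j) = \sum_(j < n) f (x j).
Proof. exact: (big_morph f star_homD star_hom0). Qed.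

End StarHom.

Section Representation.
Variables (R : realType) (A : starAlgType R[i]) (h : hilbertType R).
Variable rho : A -> h -> h.
Hypothesis hrho : representation rho.

Lemma rep_opD a u v : rho a (u + v) = rho a u + rho a v.
Proof. by have := rep_op_linear hrho a 1 u v; rewrite !scale1r. Qed.

Lemma rep_op0 a : rho a 0 = 0.
Proof. by apply: (addIr (rho a 0)); rewrite -rep_opD !add0r. Qed.

Lemma rep_opZ a c v : rho a (c *: v) = c *: rho a v.
Proof. by have := rep_op_linear hrho a c v 0; rewrite rep_op0 !addr0. Qed.

Lemma rep_opB a u v : rho a (u - v) = rho a u - rho a v.
Proof. by rewrite rep_opD -scaleN1r rep_opZ scaleN1r. Qed.

Lemma rep_opN a v : rho a (- v) = - rho a v.
Proof. by rewrite -scaleN1r rep_opZ scaleN1r. Qed.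

Lemma repD a b v : rho (a + b) v = rho a v + rho b v.
Proof. by have := rep_linear hrho 1 a b v; rewrite !scale1r. Qed.

Lemma rep0 v : rho 0 v = 0.
Proof. by apply: (addIr (rho 0 v)); rewrite -repD !add0r. Qed.

Lemma repZ c a v : rho (c *: a) v = c *: rho a v.
Proof. by have := rep_linear hrho c a 0 v; rewrite rep0 !addr0. Qed.

Lemma repSr a u v : inner (rho a u) v = inner u (rho (star a) v).
Proof. by rewrite -(repS hrho) starK. Qed.

End Representation.

(** * The *-algebra of Schürmann matrices *)

Section SchurmannAlgebra.
Variables (R : realType) (A : starAlgType R[i]) (h : hilbertType R).
Variables (eps : A -> R[i]) (rho : A -> h -> h).

(** The proofs in the type make the algebra structure below, which exists only
    for a character [eps] and a representation [rho], canonical. *)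
Definition schurmann_alg of star_hom (eps : A -> R[i]^o) & representation rho
  : Type := (A * h * h * R[i])%type.

Variables (heps : star_hom (eps : A -> R[i]^o)) (hrho : representation rho).

Local Notation S := (schurmann_alg heps hrho).
Local Notation "x ^s" := (star x) (at level 2, format "x ^s").

HB.instance Definition _ := GRing.Zmodule.copy S (A * h * h * R[i])%type.

Definition salg (a : A) (v w : h) (l : R[i]) : S := (a, v, w, l).

Lemma salg_ind (P : S -> Prop) :
  (forall a v w l, P (salg a v w l)) -> forall x, P x.
Proof. by move=> Px [[[a v] w] l]; exact: Px. Qed.

Lemma salgD a v w l a' v' w' l' :
  salg a v w l + salg a' v' w' l' = salg (a + a') (v + v') (w + w') (l + l').
Proof. by []. Qed.

Definition salg_mul (x y : S) : S :=
  let: (a, v, w, l) := x in let: (b, v', w', l') := y in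
  salg (a * b) (rho a v' + eps b *: v) (rho b^s w + eps a^s *: w')
       (inner w v' + eps a * l' + l * eps b).

(** The third entry stands for the functional <w, .>, hence the conjugate. *)
Definition salg_scale (c : R[i]) (x : S) : S :=
  let: (a, v, w, l) := x in
  salg (c *: a) (c *: v) (Num.conj c *: w) (c * l).

Definition salg_star (x : S) : S :=
  let: (a, v, w, l) := x in salg a^s w v (Num.conj l).

Lemma salg_mulE a v w l b v' w' l' :
  salg_mul (salg a v w l) (salg b v' w' l')
  = salg (a * b) (rho a v' + eps b *: v) (rho b^s w + eps a^s *: w')
         (inner w v' + eps a * l' + l * eps b).
Proof. by []. Qed.

Lemma salg_scaleE c a v w l :
  salg_scale c (salg a v w l)
  = salg (c *: a) (c *: v) (Num.conj c *: w) (c * l).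
Proof. by []. Qed.

Lemma salg_starE a v w l :
  salg_star (salg a v w l) = salg a^s w v (Num.conj l).
Proof. by []. Qed.

Let epsD a b : eps (a + b) = eps a + eps b.
Proof. exact: (star_homD heps). Qed.
Let epsM a b : eps (a * b) = eps a * eps b.
Proof. exact: (star_homM heps). Qed.
Let epsZ c a : eps (c *: a) = c * eps a.
Proof. exact: (star_homZ heps). Qed.
Let eps1 : eps 1 = 1.
Proof. exact: (star_hom1 heps). Qed.
Let epsS a : eps a^s = Num.conj (eps a).
Proof. exact: (star_homS heps). Qed.

Let epsE := (epsD, epsM, epsZ, eps1, epsS).
Let repE := (rep_opD hrho, rep_opZ hrho, repD hrho,
  repZ hrho, repM hrho, rep1 hrho).
Let innerE := (innerDr, innerDl, innerZr, innerZl).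

Lemma salg_mulA : associative salg_mul.
Proof.
elim/salg_ind=> a v w l; elim/salg_ind=> b v' w' l'; elim/salg_ind=> c v'' w'' l''.
rewrite !salg_mulE !starM !epsE !repE !innerE (repSr hrho) starK conjCK.
rewrite !scalerDr !scalerA !addrA mulrA.
congr salg; [congr (_ + _ *: _)|congr (_ + _ *: _)|]; ring.
Qed.

Let starE := (@starD R[i] A, @starM R[i] A, @starZ R[i] A, star1 A, @starK R[i] A).

Lemma salg_mul1l : left_id (salg 1 0 0 0) salg_mul.
Proof.
elim/salg_ind=> a v w l; rewrite !salg_mulE !starE !epsE !repE.
by rewrite (rep_op0 hrho) inner0l scaler0 scale1r mul1r mul0r !(add0r, addr0) mul1r.
Qed.

Lemma salg_mul1r : right_id (salg 1 0 0 0) salg_mul.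
Proof.
elim/salg_ind=> a v w l; rewrite !salg_mulE !starE !epsE !repE.
by rewrite (rep_op0 hrho) inner0r scaler0 scale1r mulr1 mulr0 !(add0r, addr0) mulr1.
Qed.

Lemma salg_mulDl : left_distributive salg_mul +%R.
Proof.
elim/salg_ind=> a v w l; elim/salg_ind=> b v' w' l'; elim/salg_ind=> c v'' w'' l''.
rewrite [salg a _ _ _ + _]salgD !salg_mulE salgD !starE !epsE !repE !innerE mulrDl.
congr salg; [by rewrite scalerDr addrACA|by rewrite scalerDl addrACA|ring].
Qed.

Lemma salg_mulDr : right_distributive salg_mul +%R.
Proof.
elim/salg_ind=> a v w l; elim/salg_ind=> b v' w' l'; elim/salg_ind=> c v'' w'' l''.
rewrite [salg b _ _ _ + _]salgD !salg_mulE salgD !starE !epsE !repE !innerE mulrDr.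
congr salg; [by rewrite scalerDl addrACA|by rewrite scalerDr addrACA|ring].
Qed.

Lemma salg_1neq0 : salg 1 0 0 0 != 0.
Proof. by apply/eqP => -[] /eqP; rewrite oner_eq0. Qed.

HB.instance Definition _ := GRing.Zmodule_isNzRing.Build S
  salg_mulA salg_mul1l salg_mul1r salg_mulDl salg_mulDr salg_1neq0.

Lemma salgM a v w l b v' w' l' :
  salg a v w l * salg b v' w' l'
  = salg (a * b) (rho a v' + eps b *: v) (rho b^s w + eps a^s *: w')
         (inner w v' + eps a * l' + l * eps b).
Proof. by []. Qed.

Lemma salg_scaleA c d x : salg_scale c (salg_scale d x) = salg_scale (c * d) x.
Proof.
by elim/salg_ind: x => a v w l; rewrite !salg_scaleE !scalerA rmorphM mulrA.
Qed.

Lemma salg_scale1 : left_id 1 salg_scale.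
Proof. by elim/salg_ind=> a v w l; rewrite !salg_scaleE rmorph1 !scale1r mul1r. Qed.

Lemma salg_scaleDr : right_distributive salg_scale +%R.
Proof.
move=> c; elim/salg_ind=> a v w l; elim/salg_ind=> a' v' w' l'.
by rewrite [salg a _ _ _ + _]salgD !salg_scaleE salgD !scalerDr mulrDr.
Qed.

Lemma salg_scaleDl x : {morph salg_scale^~ x : c d / c + d}.
Proof.
elim/salg_ind: x => a v w l c d.
by rewrite !salg_scaleE salgD rmorphD !scalerDl mulrDl.
Qed.

HB.instance Definition _ := GRing.Zmodule_isLmodule.Build R[i] S
  salg_scaleA salg_scale1 salg_scaleDr salg_scaleDl.

Lemma salgZ c a v w l :
  c *: salg a v w l = salg (c *: a) (c *: v) (Num.conj c *: w) (c * l).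
Proof. by []. Qed.

Lemma salg_scaleAl (c : R[i]) (x y : S) : c *: (x * y) = (c *: x) * y.
Proof.
elim/salg_ind: x => a v w l; elim/salg_ind: y => a' v' w' l'.
rewrite [in LHS]salgM !salgZ salgM.
rewrite !starE !epsE !repE !innerE conjCK scalerAl.
congr salg; [by rewrite scalerDr !scalerA mulrC|by rewrite scalerDr scalerA|ring].
Qed.

HB.instance Definition _ := GRing.Lmodule_isLalgebra.Build R[i] S salg_scaleAl.

Lemma salg_scaleAr (c : R[i]) (x y : S) : c *: (x * y) = x * (c *: y).
Proof.
elim/salg_ind: x => a v w l; elim/salg_ind: y => a' v' w' l'.
rewrite [in LHS]salgM !salgZ salgM.
rewrite !starE !epsE !repE !innerE scalerAr.
congr salg; [by rewrite scalerDr scalerA|by rewrite scalerDr !scalerA mulrC|ring].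
Qed.

HB.instance Definition _ := GRing.Lalgebra_isAlgebra.Build R[i] S salg_scaleAr.

Lemma salg_starK : involutive salg_star.
Proof. by elim/salg_ind=> a v w l; rewrite !salg_starE starK conjCK. Qed.

Lemma salg_starD : {morph salg_star : x y / x + y}.
Proof.
elim/salg_ind=> a v w l; elim/salg_ind=> a' v' w' l'.
by rewrite [salg a _ _ _ + _]salgD !salg_starE salgD starD rmorphD.
Qed.

Lemma salg_starZ (c : R[i]) (x : S) :
  salg_star (c *: x) = Num.conj c *: salg_star x.
Proof.
elim/salg_ind: x => a v w l.
by rewrite salgZ !salg_starE salgZ starZ conjCK rmorphM.
Qed.

Lemma salg_starM (x y : S) : salg_star (x * y) = salg_star y * salg_star x.
Proof.
elim/salg_ind: x => a v w l; elim/salg_ind: y => a' v' w' l'.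
rewrite salgM !salg_starE salgM !starE !epsE !rmorphD !rmorphM.
by rewrite (inner_conj w) /=; congr salg; ring.
Qed.

HB.instance Definition _ := Algebra_isStarAlgebra.Build R[i] S
  salg_starK salg_starD salg_starZ salg_starM.

(** * Inner Schürmann triples *)

(** The coboundary of [- xi]; with this sign its value is [xi] at every element
    [a] with [eps a = 1] and [rho a xi = 0]. *)
Definition cobord (xi : h) (a : A) : h := eps a *: xi - rho a xi.

Lemma cobord_cocycle xi : cocycle eps rho (cobord xi).
Proof.
rewrite /cobord; split=> [c a b|a b].
  by rewrite !epsE !repE scalerBr scalerDl scalerA opprD addrACA.
rewrite (rep_opB hrho) !epsE !repE scalerBr scalerA.
by rewrite [RHS]addrC addrA subrK mulrC.
Qed.

(** This is U D U^*, where D is the diagonal matrix with entries [eps a],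
    [rho a], [eps a], and U is unipotent with [v = xi], [w = - xi] and corner
    [- inner xi xi / 2]; these entries make U unitary for the *-operation of
    [schurmann_alg]. *)
Definition salg_inner (xi : h) (a : A) : S :=
  salg a (cobord xi a) (cobord xi a^s)
       (inner xi (rho a xi) - eps a * inner xi xi).

Lemma salg_inner_hom xi : star_hom (salg_inner xi).
Proof.
have [bL bM] := cobord_cocycle xi.
split.
- move=> c a b; rewrite /salg_inner salgZ salgD !starE !bL !epsE !repE !innerE.
  by congr salg; ring.
- rewrite /salg_inner star1 /cobord eps1 (rep1 hrho) !scale1r mul1r !subrr.
  by [].
- move=> a b; rewrite /salg_inner salgM !starE !bM; congr salg.
  rewrite /cobord !epsE !innerBl !innerBr !innerZl !innerZr !(repSr hrho).
  by rewrite starK conjCK !repE; ring.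
- move=> a; rewrite /salg_inner [RHS]salg_starE starK; congr salg.
  rewrite epsS -(repSr hrho) rmorphB rmorphM /=.
  by rewrite -(inner_conj xi (rho a xi)) -(inner_conj xi xi).
Qed.

End SchurmannAlgebra.

(** * Schürmann triples as *-homomorphisms *)

Section SchurmannHom.
Variables (R : realType) (A : starAlgType R[i]) (h : hilbertType R).
Variables (eps : A -> R[i]) (rho : A -> h -> h).
Variables (heps : star_hom (eps : A -> R[i]^o)) (hrho : representation rho).
Local Notation S := (schurmann_alg heps hrho).

Definition salg_base (x : S) : A := x.1.1.1.
Definition salg_vec (x : S) : h := x.1.1.2.
Definition salg_covec (x : S) : h := x.1.2.
Definition salg_scal (x : S) : R[i] := x.2.

Lemma salg_baseM (x y : S) : salg_base (x * y) = salg_base x * salg_base y.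
Proof. by elim/salg_ind: x => *; elim/salg_ind: y. Qed.

Lemma salg_vecM (x y : S) :
  salg_vec (x * y) = rho (salg_base x) (salg_vec y) + eps (salg_base y) *: salg_vec x.
Proof. by elim/salg_ind: x => *; elim/salg_ind: y. Qed.

Lemma salg_scalM (x y : S) :
  salg_scal (x * y) = inner (salg_covec x) (salg_vec y)
    + eps (salg_base x) * salg_scal y + salg_scal x * eps (salg_base y).
Proof. by elim/salg_ind: x => *; elim/salg_ind: y. Qed.

Lemma salg_covec_star (x : S) : salg_covec (star x) = salg_vec x.
Proof. by elim/salg_ind: x. Qed.

Lemma salg_scal_star (x : S) : salg_scal (star x) = Num.conj (salg_scal x).
Proof. by elim/salg_ind: x. Qed.

Lemma salg_base_linear : linear salg_base.
Proof. by move=> c; elim/salg_ind=> a v w l; elim/salg_ind. Qed.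

Lemma salg_vec_linear : linear salg_vec.
Proof. by move=> c; elim/salg_ind=> a v w l; elim/salg_ind. Qed.

Lemma salg_scal_linear : scalar salg_scal.
Proof. by move=> c; elim/salg_ind=> a v w l; elim/salg_ind. Qed.

(** Each law of a Schürmann triple is one entry of a homomorphism law of [f]:
    since [f] commutes with *, the third entry of [f a] is [eta (star a)]. *)
Lemma salg_section_schurmann (f : A -> S) :
  star_hom f -> (forall a, salg_base (f a) = a) ->
  schurmann_triple eps rho (salg_vec \o f) (salg_scal \o f).
Proof.
move=> [fL f1 fM fS] fK; split=> //=.
- split=> [c a b|a b] /=; first by rewrite fL salg_vec_linear.
  by rewrite fM salg_vecM !fK.
- by move=> c a b /=; rewrite fL salg_scal_linear.
- by move=> a; rewrite fS salg_scal_star.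
- by move=> a b; rewrite fM salg_scalM !fK fS salg_covec_star.
Qed.

End SchurmannHom.

(** * Uniqueness on the generators *)

Section Generation.
Variables (C : numClosedFieldType) (n : nat).

(** The generators being selfadjoint, the elements that satisfy [P] along with
    their adjoints form a *-subalgebra containing them. An induction along
    products and linear combinations alone is what suits a cocycle [eta], whose
    value at [star a] is not a function of its value at [a]. *)
Lemma pol_alg_ind (P : Pol C n -> Prop) :
  (forall i j, P (pgen i j)) -> P 1 ->
  (forall c a b, P a -> P b -> P (c *: a + b)) ->
  (forall a b, P a -> P b -> P (a * b)) -> forall a, P a.
Proof.
move=> Pgen P1 PL PM.
have P0 : P 0 by rewrite -(addNr 1) -scaleN1r; exact: PL.
have PC c : P (\pi_(Pol C n) (Cst n c)).
  suff -> : \pi_(Pol C n) (Cst n c) = c *: (1 : Pol C n) + 0 by exact: PL.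
  by rewrite addr0 /GRing.scale /= /pol_scale mulr1.
suff PS x : P (\pi_(Pol C n) x) /\ P (star (\pi_(Pol C n) x)).
  by elim/pol_ind=> x; case: (PS x).
elim: x => [i j|c|x [Px Psx] y [Py Psy]|x [Px Psx] y [Py Psy]|x [Px Psx]].
- by rewrite -(magic_selfadj (pgen_magic C n)); split; exact: Pgen.
- have -> : star (\pi_(Pol C n) (Cst n c)) = \pi_(Pol C n) (Cst n (Num.conj c)).
    by rewrite -piS; exact/pi_eq/ee_starC.
  by [].
- have PD a b : P a -> P b -> P (a + b) by move=> Pa; rewrite -[a]scale1r; exact: PL.
  by rewrite piD starD; split; apply: PD.
- by rewrite piM starM; split; apply: PM.
- by rewrite piS starK.
Qed.

End Generation.

Section SchurmannPol.
Variables (R : realType) (n : nat) (h : hilbertType R).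
Variable rho : Pol R[i] n -> h -> h.
Hypothesis hrho : representation rho.
Local Notation p := (@pgen R[i] n).
Local Notation eps := (@counit R[i] n).
Local Notation S := (schurmann_alg (counit_hom R[i] n) hrho).

Let pM := pgen_magic R[i] n.

Lemma cocycle1 eta : cocycle eps rho eta -> eta 1 = 0.
Proof.
move=> [_ eM]; have := eM 1 1.
rewrite mulr1 (rep1 hrho) (star_hom1 (counit_hom R[i] n)) scale1r.
by move=> e; apply: (addIr (eta 1)); rewrite -e add0r.
Qed.

(** Along row i a cocycle agrees with the coboundary of [eta (p i i)]; for
    [i != j] this is [eta] applied to [p i j * p i i = 0]. *)
Lemma cocycle_pgen eta i j : cocycle eps rho eta ->
  rho (p i i) (eta (p i i)) = 0 ->
  eta (p i j) = cobord eps rho (eta (p i i)) (p i j).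
Proof.
move=> [eL eM] e0; rewrite /cobord counit_pgen.
have [<-|ij] := eqVneq i j; first by rewrite e0 subr0 scale1r.
have /(congr1 eta) : p i j * p i i = 0 by apply: (magic_row_orth pM); rewrite eq_sym.
rewrite eM counit_pgen eqxx scale1r scale0r.
have -> : eta 0 = 0.
  have := eL 1 0 0; rewrite !scale1r addr0 => e.
  by apply: (addIr (eta 0)); rewrite -e add0r.
by move/eqP; rewrite addrC addr_eq0 sub0r => /eqP.
Qed.

Lemma cocycle_eq eta eta' :
  cocycle eps rho eta -> cocycle eps rho eta' ->
  (forall i, rho (p i i) (eta (p i i)) = 0) ->
  (forall i, eta (p i i) = eta' (p i i)) -> eta =1 eta'.
Proof.
move=> ce ce' e0 ee'; elim/pol_alg_ind => [i j| |c a b ea eb|a b ea eb].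
- by rewrite (cocycle_pgen j ce) // (cocycle_pgen j ce') -ee'.
- by rewrite (cocycle1 ce) (cocycle1 ce').
- by rewrite (proj1 ce) (proj1 ce') ea eb.
- by rewrite (proj2 ce) (proj2 ce') ea eb.
Qed.

Lemma schurmann1 eta L : schurmann_triple eps rho eta L -> L 1 = 0.
Proof.
move=> T; have := schurmann_product T 1 1.
rewrite star1 mulr1 (star_hom1 (counit_hom R[i] n)) mul1r mulr1.
rewrite (cocycle1 (schurmann_cocycle T)) inner0r add0r => e.
by apply: (addIr (L 1)); rewrite -e add0r.
Qed.

(** The product formula for the projection [p i j] reads
    L p = <eta p, eta p> + 2 eps p L p, and 1 - 2 eps p is its own inverse. *)
Lemma schurmann_pgen eta L i j : schurmann_triple eps rho eta L ->
  L (p i j) = (1 - 2 * (i == j)%:R) * inner (eta (p i j)) (eta (p i j)).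
Proof.
move=> T; have := schurmann_product T (p i j) (p i j).
rewrite -(magic_selfadj pM) -expr2 -(magic_idem pM) counit_pgen.
set x := L _; set y := inner _ _.
case: (i == j) => /= e; first have -> : y = x - x - x by rewrite {1}e; ring.
  ring.
by rewrite [LHS]e; ring.
Qed.

Lemma schurmann_eq eta L L' :
  schurmann_triple eps rho eta L -> schurmann_triple eps rho eta L' -> L =1 L'.
Proof.
move=> T T'; elim/pol_alg_ind => [i j| |c a b ea eb|a b ea eb].
- by rewrite (schurmann_pgen _ _ T) (schurmann_pgen _ _ T').
- by rewrite (schurmann1 T) (schurmann1 T').
- by rewrite (schurmann_linear T) (schurmann_linear T') ea eb.
- rewrite -[a]starK (schurmann_product T) (schurmann_product T') starK.
  by rewrite ea eb.
Qed.

(** * Existence *)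

Section Existence.
Variable xi : 'I_n -> h.
Hypothesis hxi0 : forall i, rho (p i i) (xi i) = 0.
Hypothesis hxi : forall i j, rho (p i j) (xi i) = rho (p i j) (xi j).

Definition salg_gen i j : S := salg_inner _ hrho (xi i) (p i j).

(** For [i != j] the entries of [salg_inner v (p i j)] depend on [v] only
    through [rho (p i j) v], the corner because [rho (p i j)] is a projection. *)
Lemma salg_gen_col i j : salg_gen i j = salg_inner _ hrho (xi j) (p i j).
Proof.
rewrite /salg_gen; have [->//|ij] := eqVneq i j.
rewrite /salg_inner /cobord -(magic_selfadj pM) counit_pgen (negPf ij).
rewrite !scale0r !mul0r hxi; congr salg.
have sq u v : inner u (rho (p i j) v) = inner (rho (p i j) u) (rho (p i j) v).
  by rewrite (repSr hrho) -(magic_selfadj pM) -(repM hrho) -expr2 -(magic_idem pM).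
by rewrite sq hxi -sq.
Qed.

Lemma salg_gen_magic : magic_unitary salg_gen.
Proof.
have hom v := salg_inner_hom (counit_hom R[i] n) hrho v.
split=> [i j|i j|i j k jk|i j k jk|i|i].
- by rewrite -(star_homS (hom _)) -(magic_selfadj pM).
- by rewrite expr2 -(star_homM (hom _)) -expr2 -(magic_idem pM).
- by rewrite -(star_homM (hom _)) (magic_row_orth pM) // (star_hom0 (hom _)).
- rewrite !salg_gen_col -(star_homM (hom _)) (magic_col_orth pM) //.
  by rewrite (star_hom0 (hom _)).
- by rewrite -(star_hom_sum (hom _)) (magic_row_sum pM) (star_hom1 (hom _)).
- under eq_bigr do rewrite salg_gen_col.
  by rewrite -(star_hom_sum (hom _)) (magic_col_sum pM) (star_hom1 (hom _)).
Qed.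

(** The universal property applies to [salg_gen]; the lift is a section of the
    first entry, since this holds on the generators. *)
Lemma schurmann_exists :
  exists eta L, (forall i, eta (p i i) = xi i) /\ schurmann_triple eps rho eta L.
Proof.
pose f := pol_lift salg_gen; have fH : star_hom f := pol_lift_hom salg_gen_magic.
exists (@salg_vec _ _ _ _ _ _ _ \o f), (@salg_scal _ _ _ _ _ _ _ \o f).
split=> [i|].
  rewrite /= /f (pol_lift_pgen salg_gen_magic) /salg_vec /= /cobord.
  by rewrite counit_pgen eqxx scale1r hxi0 subr0.
apply: (salg_section_schurmann fH).
elim/pol_alg_ind => [i j| |c a b ea eb|a b ea eb].
- by rewrite /f (pol_lift_pgen salg_gen_magic).
- by rewrite (star_hom1 fH).
- by rewrite (star_hom_linear fH) salg_base_linear ea eb.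
- by rewrite (star_homM fH) salg_baseM ea eb.
Qed.

End Existence.
End SchurmannPol.

Unset Implicit Arguments.
Set Strict Implicit.

Theorem proposition8p3 (R : realType) (n : nat) (hn : (1 <= n)%N)
    (h : hilbertType R) (rho : Pol R[i] n -> h -> h)
    (hrho : representation rho) (xi : 'I_n -> h)
    (hxi0 : forall i, rho (pgen i i) (xi i) = 0)
    (hxi : forall i j, rho (pgen i j) (xi i) = rho (pgen i j) (xi j)) :
  (exists! eta : Pol R[i] n -> h,
     [/\ cocycle counit rho eta,
         forall i, eta (pgen i i) = xi i
       & eta 1 = 0]) /\
  (forall eta : Pol R[i] n -> h,
     cocycle counit rho eta ->
     (forall i, eta (pgen i i) = xi i) ->
     eta 1 = 0 ->
     exists! L : Pol R[i] n -> R[i], schurmann_triple counit rho eta L) /\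
  ((forall i j, xi i = xi j) ->
   forall eta : Pol R[i] n -> h,
     cocycle counit rho eta ->
     (forall i, eta (pgen i i) = xi i) ->
     coboundary counit rho eta).
Proof.
have [eta0 [L0 [eta0xi T0]]] := schurmann_exists hrho hxi0 hxi.
have c0 := schurmann_cocycle T0.
have uniq eta : cocycle counit rho eta -> (forall i, eta (pgen i i) = xi i) ->
    eta0 = eta.
  by move=> c e; apply/funext/(cocycle_eq hrho c0 c) => i; rewrite eta0xi.
split; [|split].
- exists eta0; split; first by split=> //; exact: cocycle1 hrho _ c0.
  by move=> eta [c e _]; exact: uniq.
- move=> eta c e _; rewrite -(uniq eta c e); exists L0; split=> // L T.
  exact/funext/(schurmann_eq hrho T0 T).
- move=> xiC eta c e; pose i0 := Ordinal hn; exists (- xi i0) => a.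
  rewrite (@cocycle_eq _ _ _ _ hrho eta (cobord counit rho (xi i0))) //.
  + by rewrite /cobord scalerN (rep_opN hrho) opprK addrC.
  + exact: cobord_cocycle (counit_hom _ _) hrho _.
  + by move=> i; rewrite e.
  + move=> i; rewrite e /cobord counit_pgen eqxx scale1r (xiC i0 i) hxi0.
    by rewrite subr0.
Qed.
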